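(* For every $\tau>0$: for every $u\in H_0^1(\Omega)$ the limit $R_u(\Phi(\xi,\cdot))=\lim_{n\to\infty}R_u(\Phi^{(n)}(\xi,\cdot))$ exists with $|R_u(\Phi(\xi,\cdot))|<\infty$ for $\mu$-almost every $\xi\in\Xi$; and there exist constants $c=c(\Omega,\tau)>0$ and $C=C(\Omega,\tau)>0$ such that $$c\,\lVert R_u\rVert_{\Phi}^2\le \lVert R_u\rVert_{-1}^2\le C\,\lVert R_u\rVert_{\Phi}^2\qquad\text{for all }u\in H_0^1(\Omega).$$
   Context: $\Omega\subset\mathbb{R}^d$, $d\ge1$, is a bounded, open, connected set with Lipschitz boundary. $\{\phi_k\}_{k\ge1}$ is an orthonormal basis of $L^2(\Omega)$ of eigenfunctions of the Dirichlet Laplacian, $-\Delta\phi_k=\lambda_k\phi_k$ in $\Omega$, $\phi_k=0$ on $\partial\Omega$, with $0<\lambda_1\le\lambda_2\le\cdots\to\infty$. Set $H_0^1(\Omega)=\{u\in L^2(\Omega):\lVert u\rVert_{H_0^1}^2:=\sum_k\lambda_k|\langle u,\phi_k\rangle|^2<\infty\}$ (with $\langle\cdot,\cdot\rangle$ the $L^2(\Omega)$ inner product; this is the usual space $H_0^1(\Omega)$), and let $H^{-1}(\Omega)$ be its dual, with norm $\lVert R\rVert_{-1}^2=\sum_k\lambda_k^{-1}|R(\phi_k)|^2=\big(\sup_{0\ne\varphi\in H_0^1(\Omega)}|R(\varphi)|/\lVert\varphi\rVert_{H_0^1}\big)^2$. $L$ is a second-order linear elliptic operator with $Lu\in H^{-1}(\Omega)$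 for all $u\in H_0^1(\Omega)$, and $f\in H^{-1}(\Omega)$. It is assumed that the problem $Lu=f$ in $\Omega$, $u=0$ on $\partial\Omega$ has a unique weak solution (i.e. a unique $u \in H_0^1(\Omega)$ with $(Lu-f)(\varphi)=0$ for all $\varphi\in H_0^1(\Omega)$). For $u\in H_0^1(\Omega)$ the residual functional is $R_u(\varphi)=(Lu-f)(\varphi)$, $\varphi\in H_0^1(\Omega)$, so $R_u\in H^{-1}(\Omega)$. $(\Xi,\mathfrak{F},\mu)$ is a probability space, $\mu[\cdot]$ is expectation under $\mu$, and $\{w_k\}_{k\ge1}$ are independent real random variables on it with mean zero and unit variance. For $\tau>0$ and $n\ge1$, $$\Phi^{(n)}(\xi,\cdot)=\tau\sum_{k=1}^n(1+\lambda_k)^{-1/2}w_k(\xi)\phi_k(\cdot),$$ and $\lVert R_u\rVert_\Phi^2:=\lim_{n\to\infty}\mu\big[|R_u(\Phi^{(n)})|^2\big]$. *)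

(* Defs.v *)
From HB Require Import structures.
From mathcomp Require Import all_boot all_order all_algebra.
From mathcomp Require Import all_classical all_reals all_analysis.

Set Implicit Arguments.
Unset Strict Implicit.
Unset Printing Implicit Defensive.
Import Order.TTheory GRing.Theory Num.Theory.
Import numFieldNormedType.Exports.
Local Open Scope classical_set_scope.
Local Open Scope ring_scope.

(** * Lebesgue measure on R^n

MathComp-Analysis has no n-dimensional Lebesgue measure.  Row vectors get the
sigma-algebra generated by the coordinates, which is the Borel one, and the
measure is the n-fold product of [lebesgue_measure]. *)

Definition measure_rV_display : measure_display -> measure_display.
Proof. exact. Qed.

Section measurable_rV.
Context {d} {T : measurableType d} {n : nat}.

Let coor : 'I_n -> 'rV[T]_n -> T := fun i x => x ord0 i.

Let rV_set0 : g_sigma_preimage coor set0.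
Proof. exact: sigma_algebra0. Qed.

Let rV_setC A : g_sigma_preimage coor A -> g_sigma_preimage coor (~` A).
Proof. exact: sigma_algebraC. Qed.

Let rV_bigcup (F : _^nat) : (forall i, g_sigma_preimage coor (F i)) ->
  g_sigma_preimage coor (\bigcup_i (F i)).
Proof. exact: sigma_algebra_bigcup. Qed.

HB.instance Definition _ := @isMeasurable.Build (measure_rV_display d)
  'rV[T]_n (g_sigma_preimage coor) rV_set0 rV_setC rV_bigcup.

Lemma measurable_coor (i : 'I_n) :
  measurable_fun [set: 'rV[T]_n] (fun x => x ord0 i).
Proof.
move=> _ Y mY; rewrite setTI; apply: sub_sigma_algebra => /=.
rewrite -bigcup_seq/=; exists i => /=; first by rewrite mem_index_enum.
by exists Y => //; rewrite setTI.
Qed.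

Lemma measurable_fun_rV d1 (T1 : measurableType d1) (f : T1 -> 'rV[T]_n) :
  (forall i, measurable_fun [set: T1] (fun x => f x ord0 i)) ->
  measurable_fun [set: T1] f.
Proof.
move=> mf; apply: (@measurability _ _ _ _ _ _
  (\big[setU/set0]_(i < n) preimage_set_system setT (coor i) measurable)) => //.
move=> _ [B + <-]; rewrite -bigcup_seq => -[i _ [A mA <-]].
by have := mf i measurableT A mA; rewrite !setTI.
Qed.

End measurable_rV.

Section lebesgue_rV.
Variable R : realType.

Definition rV_cons n (p : measurableTypeR R * 'rV[R]_n) :
  'rV[R]_n.+1 :=
  \row_i if unlift ord0 i is Some j then p.2 ord0 j else p.1.

Definition rV_uncons n (x : 'rV[R]_n.+1) :
  measurableTypeR R * 'rV[R]_n :=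
  (x ord0 ord0, \row_i x ord0 (lift ord0 i)).

Lemma rV_consK n : cancel (@rV_cons n) (@rV_uncons n).
Proof.
move=> [a x]; rewrite /rV_uncons /rV_cons mxE unlift_none; congr pair.
by apply/rowP => i; rewrite !mxE liftK.
Qed.

Lemma measurable_rV_cons n : measurable_fun [set: _] (@rV_cons n).
Proof.
apply: measurable_fun_rV => i; rewrite /rV_cons.
under eq_fun do rewrite mxE.
case: unliftP => [j _|_]; last exact: measurable_fst.
exact: (measurableT_comp (measurable_coor j) measurable_snd).
Qed.

Lemma measurable_rV_uncons n : measurable_fun [set: _] (@rV_uncons n).
Proof.
apply: measurable_fun_pair; first exact: measurable_coor.
apply: measurable_fun_rV => i; under eq_fun do rewrite mxE.
exact: measurable_coor.
Qed.


Section step.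
Variables (n : nat) (m : {sigma_finite_measure set 'rV[R]_n -> \bar R}).

Definition lebesgue_rVS : set 'rV[R]_n.+1 -> \bar R :=
  pushforward (lebesgue_measure \x m)%E (@rV_cons n).

Let lebesgue_rVS0 : lebesgue_rVS set0 = 0%E.
Proof. by rewrite /lebesgue_rVS /pushforward preimage_set0 measure0. Qed.

Let lebesgue_rVS_ge0 A : (0 <= lebesgue_rVS A)%E.
Proof. exact: (@measure_ge0 _ _ _ (lebesgue_measure \x m)%E). Qed.

Let lebesgue_rVS_sigma_additive : semi_sigma_additive lebesgue_rVS.
Proof.
move=> F mF tF mUF; rewrite /lebesgue_rVS /pushforward preimage_bigcup.
apply: measure_semi_sigma_additive.
- move=> k; rewrite -[X in measurable X]setTI.
  by apply: measurable_rV_cons.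
- apply/trivIsetP => /= i j _ _ ij; rewrite -preimage_setI.
  by move/trivIsetP : tF => /(_ _ _ _ _ ij) ->//; rewrite preimage_set0.
- rewrite -preimage_bigcup -[X in measurable X]setTI.
  by apply: measurable_rV_cons.
Qed.

HB.instance Definition _ := isMeasure.Build _ _ _
  lebesgue_rVS lebesgue_rVS0 lebesgue_rVS_ge0 lebesgue_rVS_sigma_additive.

Let lebesgue_rVS_sigma_finite : sigma_finite setT lebesgue_rVS.
Proof.
have [F [FT ndF Ffin]] := (sigma_finiteP _ _).1 (sigma_finiteT (@lebesgue_measure R)).
have [G [GT ndG Gfin]] := (sigma_finiteP _ _).1 (sigma_finiteT m).
exists (fun k => @rV_uncons n @^-1` (F k `*` G k)).
  apply/esym; rewrite -preimage_bigcup -subTset => x _ /=.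
  have [k _ Fk] : (\bigcup_k F k) (rV_uncons x).1 by rewrite -FT.
  have [l _ Gl] : (\bigcup_k G k) (rV_uncons x).2 by rewrite -GT.
  exists (maxn k l) => //; split.
    exact: (subsetPset _ _ (ndF _ _ (leq_maxl k l))).
  exact: (subsetPset _ _ (ndG _ _ (leq_maxr k l))).
move=> k; have [mF Fk] := Ffin k; have [mG Gk] := Gfin k; split.
  rewrite -[X in measurable X]setTI.
  by apply: measurable_rV_uncons => //; exact: measurableX.
rewrite /lebesgue_rVS /pushforward -comp_preimage.
rewrite (_ : _ \o _ = id); last by apply/funext => p /=; rewrite rV_consK.
by rewrite preimage_id product_measure1E// lte_mul_pinfty// ge0_fin_numE.
Qed.

HB.instance Definition _ := Measure_isSigmaFinite.Build _ _ _
  lebesgue_rVS lebesgue_rVS_sigma_finite.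

End step.

Fixpoint lebesgue_rV n : {sigma_finite_measure set 'rV[R]_n -> \bar R} :=
  match n with
  | 0 => \d_(0 : 'rV[R]_0)
  | n'.+1 => lebesgue_rVS (lebesgue_rV n')
  end.

End lebesgue_rV.

Section domain.
Variables (R : realType) (n : nat).
Local Notation E := 'rV[R]_n.+1.

(** Near each boundary point, after an orthogonal change of coordinates
[y = x *m Q], the set is the part of a ball lying above the graph of a Lipschitz
function [gam] of the other [n] coordinates ([col'] drops coordinate 0).  The
balls are those of the sup norm, which makes no difference here. *)
Definition lipschitz_boundary (Omega : set E) : Prop :=
  forall p : E, (closure Omega `\` Omega°) p ->
  exists (r : R) (Q : 'M[R]_n.+1) (gam : 'rV[R]_n -> R) (k : R),
    [/\ 0 < r, Q *m Q^T = 1%:M, k.-lipschitz gam &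
      forall x : E, ball p r x ->
        (Omega x <-> gam (col' ord0 (x *m Q)) < (x *m Q) ord0 ord0)].

End domain.

Section function_spaces.
Variables (R : realType) (n : nat).
Local Notation E := 'rV[R]_n.
Local Notation leb := (lebesgue_rV R n).
Implicit Types (Omega : set E) (u v psi : E -> R) (g : 'I_n -> E -> R).

Definition partial (i : 'I_n) (u : E -> R) : E -> R :=
  fun x => 'D_(delta_mx ord0 i) u x.

Definition iter_partial (s : seq 'I_n) (u : E -> R) : E -> R :=
  foldr partial u s.

Definition smooth u : Prop :=
  forall s : seq 'I_n, continuous (iter_partial s u) /\
    forall i x, derivable (iter_partial s u) x (delta_mx ord0 i).

Definition test_function Omega psi : Prop :=
  smooth psi /\
  exists K : set E, [/\ compact K, K `<=` Omega & forall x, ~ K x -> psi x = 0].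

(** Elements of [L^2(Omega)] are represented by functions on the whole space
whose values outside [Omega] are irrelevant; equality is a.e. equality. *)
Definition L2 Omega u : Prop :=
  measurable_fun Omega u /\ leb.-integrable Omega (fun x => (u x ^+ 2)%:E).

Definition ip Omega u v : R := (\int[leb]_(x in Omega) (u x * v x))%R.

Definition ae_eq_on Omega u v : Prop :=
  {ae leb, forall x, Omega x -> u x = v x}.

Definition cvg_L2 Omega (us : nat -> E -> R) u : Prop :=
  (\int[leb]_(x in Omega) ((us k x - u x) ^+ 2)%:E)%E @[k --> \oo] --> 0%E.

Definition weak_gradient Omega u g : Prop :=
  [/\ L2 Omega u, forall i, L2 Omega (g i) &
    forall i psi, test_function Omega psi ->
      ip Omega u (partial i psi) = - ip Omega (g i) psi].

(** [u] is in the [H^1]-closure of [C_c^oo(Omega)], with gradient [g]. *)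
Definition in_closure_test Omega u g : Prop :=
  [/\ L2 Omega u, forall i, L2 Omega (g i) &
    exists psi : nat -> E -> R,
      [/\ forall k, test_function Omega (psi k), cvg_L2 Omega psi u &
        forall i, cvg_L2 Omega (fun k => partial i (psi k)) (g i)]].

(** Weak form of [- Laplacian phi = lam phi] in [Omega], [phi = 0] on the
boundary. *)
Definition dirichlet_eigenpair Omega (phi : E -> R) (lam : R) : Prop :=
  exists g, in_closure_test Omega phi g /\
    forall psi, test_function Omega psi ->
      \sum_(i < n) ip Omega (g i) (partial i psi) = lam * ip Omega phi psi.

(** The index [k : nat] stands for [k + 1] in the usual numbering. *)
Definition dirichlet_eigenbasis Omega
    (phi : nat -> E -> R) (lam : nat -> R) : Prop :=
  [/\ forall k, dirichlet_eigenpair Omega (phi k) (lam k),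
      forall j k, ip Omega (phi j) (phi k) = (j == k)%:R,
      forall u, L2 Omega u ->
        cvg_L2 Omega
          (fun N x => \sum_(k < N) ip Omega u (phi k) * phi k x) u,
      0 < lam 0 &
      {homo lam : j k / (j <= k)%N >-> j <= k} /\ lam k @[k --> \oo] --> +oo].

End function_spaces.

Section spectral_spaces.
Variables (R : realType) (n : nat).
Local Notation E := 'rV[R]_n.
Local Notation leb := (lebesgue_rV R n).
Variables (Omega : set E) (phi : nat -> E -> R) (lam : nat -> R).

Definition H01_sqnorm (u : E -> R) : \bar R :=
  (\sum_(k <oo) (lam k * `|ip Omega u (phi k)| ^+ 2)%:E)%E.

Definition H01 (u : E -> R) : Prop :=
  L2 Omega u /\ (H01_sqnorm u < +oo)%E.

Definition H01_norm (u : E -> R) : R := Num.sqrt (fine (H01_sqnorm u)).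

(** Functionals are total functions, but only their values on [H01] matter. *)
Definition Hm1 (l : (E -> R) -> R) : Prop :=
  (forall (a : R) u v, H01 u -> H01 v ->
     l (fun x => a * u x + v x) = a * l u + l v) /\
  exists M : R, forall u, H01 u -> `|l u| <= M * H01_norm u.

Definition Hm1_norm (l : (E -> R) -> R) : \bar R :=
  ereal_sup [set (`|l v| / H01_norm v)%:E
            | v in [set v | H01 v /\ ~ ae_eq_on Omega v (fun=> 0)]].

(** [L u = - div (a Du + u b) + c . Du + e u] in the sense of distributions,
where the matrix [a] is positive definite almost everywhere. *)
Definition elliptic_operator (L : (E -> R) -> (E -> R) -> R) : Prop :=
  exists (a : 'I_n -> 'I_n -> E -> R) (b c : 'I_n -> E -> R) (e : E -> R),
    [/\ [/\ forall i j, measurable_fun Omega (a i j),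
            forall i, measurable_fun Omega (b i),
            forall i, measurable_fun Omega (c i) & measurable_fun Omega e],
        {ae leb, forall x, Omega x -> forall xi : E, xi != 0 ->
          0 < \sum_(i < n) \sum_(j < n) a i j x * xi ord0 i * xi ord0 j} &
        forall u g psi, H01 u -> weak_gradient Omega u g ->
          test_function Omega psi ->
          let form x :=
            \sum_(i < n) (\sum_(j < n) a i j x * g j x + b i x * u x)
                           * partial i psi x
            + (\sum_(i < n) c i x * g i x + e x * u x) * psi x in
          leb.-integrable Omega (EFin \o form) /\
          L u psi = (\int[leb]_(x in Omega) form x)%R].

Definition linear_operator (L : (E -> R) -> (E -> R) -> R) : Prop :=
  forall (a : R) u v w, H01 u -> H01 v -> H01 w ->
    L (fun x => a * u x + v x) w = a * L u w + L v w.

Definition residual (L : (E -> R) -> (E -> R) -> R) (f : (E -> R) -> R)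
    (u : E -> R) : (E -> R) -> R :=
  fun v => L u v - f v.

Definition weak_solution (L : (E -> R) -> (E -> R) -> R) (f : (E -> R) -> R)
    (u : E -> R) : Prop :=
  H01 u /\ forall v, H01 v -> residual L f u v = 0.

Definition elliptic_problem (L : (E -> R) -> (E -> R) -> R)
    (f : (E -> R) -> R) : Prop :=
  [/\ elliptic_operator L /\ linear_operator L,
      forall u, H01 u -> Hm1 (L u),
      Hm1 f &
      exists2 u, weak_solution L f u &
        forall v, weak_solution L f v -> ae_eq_on Omega v u].

End spectral_spaces.

Section noise.
Variables (R : realType) (d : measure_display) (Xi : measurableType d).
Variable mu : probability Xi R.

Definition mutually_independent (w : nat -> {RV mu >-> R}) : Prop :=
  forall (s : seq nat) (B : nat -> set R),
    uniq s -> (forall k, k \in s -> measurable (B k)) ->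
    mu (\bigcap_(k in [set` s]) (w k @^-1` B k))
      = (\prod_(k <- s) mu (w k @^-1` B k))%E.

Definition white_noise (w : nat -> {RV mu >-> R}) : Prop :=
  [/\ mutually_independent w,
      forall k, ('E_mu[w k] = 0)%E & forall k, ('V_mu[w k] = 1)%E].

Variables (n : nat) (phi : nat -> 'rV[R]_n -> R) (lam : nat -> R) (tau : R).

Definition Phi (w : nat -> {RV mu >-> R}) (N : nat) (xi : Xi) :
  'rV[R]_n -> R :=
  fun x => tau *
    \sum_(k < N) (Num.sqrt (1 + lam k))^-1 * w k xi * phi k x.

Definition mean_sq (w : nat -> {RV mu >-> R}) (r : ('rV[R]_n -> R) -> R)
    (N : nat) : \bar R :=
  'E_mu[fun xi => `|r (Phi w N xi)| ^+ 2].

Definition Phi_sqnorm (w : nat -> {RV mu >-> R}) (r : ('rV[R]_n -> R) -> R) :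
  \bar R := limn (mean_sq w r).

End noise.

(* Main.v *)
Require Import Defs.
From HB Require Import structures.
From mathcomp Require Import all_boot all_order all_algebra.
From mathcomp Require Import all_classical all_reals all_analysis.
From mathcomp Require Import measurable_realfun ring lra.

Set Implicit Arguments.
Unset Strict Implicit.
Unset Printing Implicit Defensive.
Import Order.TTheory GRing.Theory Num.Theory.
Import numFieldNormedType.Exports.
Local Open Scope classical_set_scope.
Local Open Scope ring_scope.

(** A functional l in the dual of H01, such as the residual of u, is known
through its values r_k = l (phi k), and both norms are weighted l^2 norms of
that one sequence: the squared dual norm is the sum of r_k ^ 2 / lam k
([Hm1_normE]), while the squared noise norm is tau ^ 2 times the sum of
r_k ^ 2 / (1 + lam k), because the w k are orthonormal in L^2 of the
probability space ([mean_sq_noise_sum]).  The two weights differ by the factor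
(1 + lam k) / lam k, which lies between 1 and 1 + 1 / lam 0, whence
c = tau ^ -2 and C = (1 + 1 / lam 0) / tau ^ 2.

The constants have to serve every eigenbasis of Omega at once, so lam 0 must
not depend on the eigenbasis.  An eigenfunction of one basis is not orthogonal
to all the eigenfunctions of another, and two eigenfunctions that are not
orthogonal have the same eigenvalue, since testing the weak equation of each
with the other is legitimate by density ([eigenpair_exchange],
[first_eigenvalue_le]).

Almost sure convergence is Kolmogorov's theorem: a series of independent
centred variables with summable variances converges almost surely
([random_series_cvg]); the variances are those just summed.  The maximal
inequality behind it is obtained by freezing the partial sums once they exceed
a threshold.  The frozen process is a martingale transform, so that its second
moment is still at most the sum of the variances, and Chebyshev's inequality
for its terminal value controls the whole path ([Kolmogorov_maximal]).
Orthogonality and freezing both rest on one fact: a function of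
w 0, ..., w (N - 1) times w N has mean zero ([expectation_indep_centered],
[past_independent]). *)

(** * Square-integrable functions *)

(** Discriminant inequality behind every Cauchy-Schwarz inequality below; it
includes the degenerate quadratic c = 0, where only b = 0 is possible. *)
Lemma discr_le (R : realFieldType) (a b c : R) :
  0 <= a -> 0 <= c ->
  (forall t, 0 <= a + 2 * t * b + t ^+ 2 * c) -> b ^+ 2 <= a * c.
Proof.
move=> a0 c0 P; have [c_eq0|c_neq0] := eqVneq c 0.
  have [->|b_neq0] := eqVneq b 0; first by rewrite expr0n/= mulr_ge0.
  have := P (- ((a + 1) / (2 * b))); rewrite c_eq0 mulr0 addr0.
  have -> : a + 2 * - ((a + 1) / (2 * b)) * b = - 1 by field.
  by rewrite oppr_ge0 ler10.
have c_gt0 : 0 < c by rewrite lt_neqAle eq_sym c_neq0.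
have := P (- (b / c)).
have -> : a + 2 * - (b / c) * b + (- (b / c)) ^+ 2 * c = a - b ^+ 2 / c.
  by field.
by rewrite subr_ge0 ler_pdivrMr.
Qed.

(** On the domain this specializes definitionally to [L2] and [ip]; on the
probability space it gives second moments. *)
Section sq_integrable.
Context d (T : measurableType d) (R : realType).
Variables (mu : {measure set T -> \bar R}) (D : set T).
Hypothesis mD : measurable D.
Implicit Types u v : T -> R.

Definition sq_integrable u : Prop :=
  measurable_fun D u /\ mu.-integrable D (fun x => (u x ^+ 2)%:E).

Definition dot u v : R := (\int[mu]_(x in D) (u x * v x))%R.

Lemma sqi_mul u v : sq_integrable u -> sq_integrable v ->
  mu.-integrable D (EFin \o (fun x => u x * v x)).
Proof.
move=> [mu_ iu] [mv iv].
apply: (@le_integrable _ _ _ mu D mD _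
  (fun x => (u x ^+ 2)%:E + (v x ^+ 2)%:E)%E).
- by apply/measurable_EFinP; apply: measurable_funM.
- move=> x Dx /=; rewrite lee_fin normrM.
  have h : 0 <= (`|u x| - `|v x|) ^+ 2 by exact: sqr_ge0.
  have := ler_norm (u x ^+ 2 + v x ^+ 2).
  rewrite sqrrB !real_normK ?num_real// in h.
  have h0 : 0 <= `|u x| * `|v x| by rewrite mulr_ge0.
  by move: h h0; lra.
- exact: integrableD.
Qed.

Lemma sqiD u v : sq_integrable u -> sq_integrable v ->
  sq_integrable (fun x => u x + v x).
Proof.
move=> su sv; have [mu_ iu] := su; have [mv iv] := sv.
split; first exact: measurable_funD.
have iuv := sqi_mul su sv.
have := integrableD mD (integrableD mD iu iv) (integrableZl mD 2 iuv).
apply: eq_integrable => // x _ /=.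
by rewrite -EFinM -!EFinD; congr EFin; ring.
Qed.

Lemma sqiZ k u : sq_integrable u -> sq_integrable (fun x => k * u x).
Proof.
move=> [mu_ iu]; split; first exact: measurable_funM.
have := integrableZl mD (k ^+ 2) iu.
by apply: eq_integrable => // x _; rewrite -EFinM exprMn.
Qed.

Lemma sqi0 : sq_integrable (fun=> 0).
Proof.
split => //; have := integrable0 mu D.
by apply: eq_integrable => // x _; rewrite expr0n.
Qed.

Lemma sqiB u v : sq_integrable u -> sq_integrable v ->
  sq_integrable (fun x => u x - v x).
Proof.
move=> su sv; have := sqiD su (sqiZ (-1) sv).
by under eq_fun do rewrite mulN1r.
Qed.

Lemma sqi_sum (I : Type) (s : seq I) (f : I -> T -> R) :
  (forall i, sq_integrable (f i)) ->
  sq_integrable (fun x => \sum_(i <- s) f i x).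
Proof.
move=> sf; elim: s => [|i s ih].
  by under eq_fun do rewrite big_nil; exact: sqi0.
by under eq_fun do rewrite big_cons; exact: sqiD.
Qed.

Lemma dotC u v : dot u v = dot v u.
Proof. by rewrite /dot; under eq_Rintegral do rewrite mulrC. Qed.

Lemma dotDl u v z : sq_integrable u -> sq_integrable v -> sq_integrable z ->
  dot (fun x => u x + v x) z = dot u z + dot v z.
Proof.
move=> su sv sz; rewrite /dot -RintegralD//; try exact: sqi_mul.
by under eq_Rintegral do rewrite mulrDl.
Qed.

Lemma dotZl k u v : sq_integrable u -> sq_integrable v ->
  dot (fun x => k * u x) v = k * dot u v.
Proof.
move=> su sv; rewrite /dot -RintegralZl//; last exact: sqi_mul.
by under eq_Rintegral do rewrite -mulrA.
Qed.

Lemma dotBl u v z : sq_integrable u -> sq_integrable v -> sq_integrable z ->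
  dot (fun x => u x - v x) z = dot u z - dot v z.
Proof.
move=> su sv sz; rewrite /dot -RintegralB//; try exact: sqi_mul.
by under eq_Rintegral do rewrite mulrBl.
Qed.

Lemma dot_suml (I : Type) (s : seq I) (f : I -> T -> R) z :
  (forall i, sq_integrable (f i)) -> sq_integrable z ->
  dot (fun x => \sum_(i <- s) f i x) z = \sum_(i <- s) dot (f i) z.
Proof.
move=> sf sz; elim: s => [|i s ih].
  rewrite big_nil /dot; under eq_Rintegral do rewrite big_nil mul0r.
  by rewrite Rintegral_cst// mul0r.
rewrite big_cons -ih -dotDl//; last exact: sqi_sum.
by under [X in dot X]eq_fun do rewrite big_cons.
Qed.

Lemma dot0 : dot (fun=> 0) (fun=> 0) = 0.
Proof.
rewrite /dot; under eq_Rintegral do rewrite mulr0.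
by rewrite Rintegral_cst// mul0r.
Qed.

Lemma dotZ k u : sq_integrable u ->
  dot (fun x => k * u x) (fun x => k * u x) = k ^+ 2 * dot u u.
Proof.
move=> su; have sku := sqiZ k su.
by rewrite (dotZl k su sku) dotC (dotZl k su su) mulrA -expr2.
Qed.

Lemma dot_ge0 u : 0 <= dot u u.
Proof. by apply: Rintegral_ge0 => x _; rewrite -expr2 sqr_ge0. Qed.

Lemma integral_sqr u : sq_integrable u ->
  (\int[mu]_(x in D) (u x ^+ 2)%:E)%E = (dot u u)%:E.
Proof.
move=> [mu_ iu]; rewrite /dot /Rintegral fineK.
  by apply: eq_integral => x _; rewrite expr2.
by under eq_integral do rewrite -expr2; exact: integrable_fin_num.
Qed.

Lemma dot_sqrD u v : sq_integrable u -> sq_integrable v ->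
  dot (fun x => u x + v x) (fun x => u x + v x) =
  dot u u + 2 * dot u v + dot v v.
Proof.
move=> su sv; have suv := sqiD su sv; pose uv x := u x + v x.
rewrite (dotDl su sv suv) (dotC u uv) (dotC v uv).
rewrite (dotDl su sv su) (dotDl su sv sv).
by rewrite (dotC v u); ring.
Qed.

Lemma dot_CauchySchwarz u v : sq_integrable u -> sq_integrable v ->
  dot u v ^+ 2 <= dot u u * dot v v.
Proof.
move=> su sv; apply: discr_le; rewrite ?dot_ge0// => t.
have := dot_ge0 (fun x => u x + t * v x).
have stv := sqiZ t sv.
rewrite (dot_sqrD su stv) (dotC u (fun x => t * v x)) (dotZl t sv su) mulrA.
by rewrite (dotC v u) (dotZ t sv).
Qed.

(** Turns a finite bound on an extended integral into membership. *)
Lemma integral_sqr_lty u : measurable_fun D u ->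
  (\int[mu]_(x in D) (u x ^+ 2)%:E < +oo)%E -> sq_integrable u.
Proof.
move=> mu_ lty; split => //; apply/integrableP; split.
  by apply/measurable_EFinP; exact: measurable_funX.
apply: le_lt_trans lty; rewrite le_eqVlt; apply/orP; left; apply/eqP.
by apply: eq_integral => x _ /=; rewrite ger0_norm// sqr_ge0.
Qed.

End sq_integrable.

(** * Borel sets of row vectors *)

Section rV_boxes.
Variables (R : realType) (N : nat).

(** The sides are indexed by [nat] rather than by ['I_N], to match the families
of events in the definition of mutual independence. *)
Definition rV_boxes : set (set 'rV[R]_N) :=
  [set A | exists B : nat -> set R, (forall k, measurable (B k)) /\
     A = [set x : 'rV[R]_N | forall i : 'I_N, B i (x ord0 i)]].

Lemma measurable_rV_box (B : 'I_N -> set R) : (forall k, measurable (B k)) ->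
  measurable [set x : 'rV[R]_N | forall i : 'I_N, B i (x ord0 i)].
Proof.
move=> mB.
have -> : [set x : 'rV[R]_N | forall i : 'I_N, B i (x ord0 i)] =
    \big[setI/setT]_(i < N) ((fun x : 'rV[R]_N => x ord0 i) @^-1` B i).
  rewrite -(bigcap_seq (index_enum 'I_N)
    (fun i => (fun x : 'rV[R]_N => x ord0 i) @^-1` B i)).
  apply/seteqP; split => x /= Bx i.
    by move=> _; exact: Bx.
  by apply: Bx; rewrite /= mem_index_enum.
apply: bigsetI_measurable => i _; rewrite -[X in measurable X]setTI.
exact: measurable_coor.
Qed.

(** Boxes are an intersection-stable generator, so measures on row vectors may
be compared on boxes alone. *)
Lemma measurable_rV_boxesE :
  @measurable _ ('rV[R]_N : measurableType _) = <<s rV_boxes >>.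
Proof.
apply/seteqP; split.
  apply: smallest_sub; first exact: smallest_sigma_algebra.
  move=> A; rewrite -bigcup_seq => -[i _ [B mB <-]].
  apply: sub_sigma_algebra; exists (fun k : nat => if k == i then B else setT).
  split=> [k|]; first by case: ifP.
  apply/seteqP; split => x /=.
    by move=> [_ Bx] j; case: ifPn => [/eqP/val_inj ->|_].
  by move=> Bx; split=> //; have := Bx i; rewrite eqxx.
apply: smallest_sub; first exact: sigma_algebra_measurable.
by move=> _ [B [mB ->]]; apply: (@measurable_rV_box (fun i => B i)).
Qed.

Lemma rV_boxesI : setI_closed rV_boxes.
Proof.
move=> _ _ [B [mB ->]] [C [mC ->]]; exists (fun k => B k `&` C k).
split=> [k|]; first exact: measurableI.
apply/seteqP; split => x /=; first by move=> [Bx Cx] i.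
by move=> BCx; split => i; have [] := BCx i.
Qed.

Lemma rV_boxesT : rV_boxes setT.
Proof. by exists (fun=> setT); split=> //; apply/seteqP; split. Qed.

End rV_boxes.

Section borel_rV.
Variables (R : realType) (n : nat).
Local Notation E := 'rV[R]_n.

Let rat_box (c : 'rV[rat]_n * nat) : set E :=
  [set x | forall i, `|x ord0 i - ratr (c.1 ord0 i)| < c.2.+1%:R^-1].

Let measurable_rat_box c : measurable (rat_box c).
Proof.
apply: (@measurable_rV_box _ _
  (fun i => [set y | `|y - ratr (c.1 ord0 i)| < c.2.+1%:R^-1])) => i.
rewrite -[X in measurable X]setTI.
rewrite (_ : [set y | _] = (fun y : R => `|y - ratr (c.1 ord0 i)|) @^-1`
    `]-oo, c.2.+1%:R^-1[%classic); last first.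
  by apply/seteqP; split=> y /=; rewrite in_itv/=.
have : measurable_fun [set: R] (fun y : R => `|y - ratr (c.1 ord0 i)|).
  by apply: measurableT_comp => //; exact: measurable_funB.
by apply.
Qed.

(** An open set is the union of the countably many rational boxes that it
contains. *)
Lemma open_measurable_rV (A : set E) : open A -> measurable A.
Proof.
move=> oA.
pose F c := if `[< rat_box c `<=` A >] then rat_box c else set0.
suff -> : A = \bigcup_c F c.
  apply: countable_bigcupT_measurable; first exact: countableP.
  by move=> c; rewrite /F; case: ifP.
apply/seteqP; split; last first.
  by move=> x [c _]; rewrite /F; case: ifPn => // /asboolP cA /cA.
move=> x Ax; have : nbhs x A by exact: open_nbhs_nbhs.
move=> /nbhs_ballP[e /= e0 eA].
(* A box of half-width 1 / k.+1 that contains x lies in the ball of radius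
   2 / k.+1 around x. *)
have [k ke] : exists k : nat, k.+1%:R^-1 + k.+1%:R^-1 < e.
  exists (Num.truncn (2 / e)).
  suff : (Num.truncn (2 / e)).+1%:R^-1 < e / 2.
    by move=> h; rewrite [ltRHS]splitr ltrD.
  by rewrite invf_plt ?posrE ?divr_gt0// invf_div truncnS_gt.
have /choice[q qx] (i : 'I_n) :
    exists q : rat, `|x ord0 i - ratr q| < k.+1%:R^-1.
  have : x ord0 i - k.+1%:R^-1 < x ord0 i + k.+1%:R^-1.
    by rewrite ltrD2l gt0_cp// invr_gt0.
  move=> /rat_in_itvoo[q]; rewrite in_itv/= => /andP[xq qx].
  by exists q; rewrite ltr_distlC xq.
exists (\row_i q i, k) => //; rewrite /F ifT.
  by move=> i; rewrite /= mxE.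
apply/asboolP => y yq; apply: eA; split=> // i j.
rewrite ord1; apply: le_lt_trans ke.
have := qx j; have := yq j; rewrite /= mxE => /ltW h1 /ltW h2.
rewrite (le_trans (ler_distD (ratr (q j)) _ _))// lerD// distrC//.
Qed.

Lemma continuous_measurable_rV (f : E -> R) :
  continuous f -> measurable_fun [set: E] f.
Proof.
move=> cf; apply: (measurability _ (RGenOpens.measurableE R)).
move=> _ [_ [a [b ->] <-]]; rewrite setTI; apply: open_measurable_rV.
by apply: open_comp => [x _|]; [exact: cf|exact: interval_open].
Qed.

End borel_rV.

(** * The first eigenvalue depends on the domain only *)

Section cvg_dot.
Context d (T : measurableType d) (R : realType).
Variables (mu : {measure set T -> \bar R}) (D : set T).
Hypothesis mD : measurable D.

(** Only measurability of the approximants is assumed: from some index on, their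
distance to v is finite, which makes them square-integrable. *)
Lemma cvg_dot (u v : T -> R) (vs : nat -> T -> R) :
  sq_integrable mu D u -> sq_integrable mu D v ->
  (forall k, measurable_fun D (vs k)) ->
  (\int[mu]_(x in D) ((vs k x - v x) ^+ 2)%:E)%E @[k --> \oo] --> 0%E ->
  dot mu D u (vs k) @[k --> \oo] --> dot mu D u v.
Proof.
move=> su sv mvs /fine_cvgP[finI /cvgrPdist_lt cvgI].
apply/cvgrPdist_lt => e e0.
have A1 : 0 < 1 + dot mu D u u by rewrite ltr_pwDl// dot_ge0.
have c0 : 0 < e ^+ 2 / (1 + dot mu D u u) by rewrite divr_gt0// exprn_gt0.
near=> k.
pose r x := vs k x - v x.
have sr : sq_integrable mu D r.
  apply: integral_sqr_lty; first by apply: measurable_funB => //; case: sv.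
  rewrite -ge0_fin_numE; last first.
    by apply: integral_ge0 => x _; rewrite lee_fin sqr_ge0.
  by rewrite /r {r}; near: k.
have -> : dot mu D u (vs k) = dot mu D u r + dot mu D u v.
  rewrite ![dot _ _ u _]dotC -dotDl//; congr dot.
  by apply/funext => x; rewrite subrK.
rewrite opprD addrCA subrr addr0 normrN.
rewrite -(ltr_pXn2r (ltn0Sn 1)) ?nnegrE//; last exact: ltW.
rewrite real_normK ?num_real//.
apply: le_lt_trans (dot_CauchySchwarz mD su sr) _.
have : dot mu D r r < e ^+ 2 / (1 + dot mu D u u).
  have : `|0 - fine (\int[mu]_(x in D) ((vs k x - v x) ^+ 2)%:E)%E| <
      e ^+ 2 / (1 + dot mu D u u) by near: k; exact: cvgI.
  by rewrite sub0r normrN integral_sqr//= ger0_norm// dot_ge0.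
rewrite ltr_pdivlMr// mulrC => /(le_lt_trans _); apply.
by rewrite ler_wpM2r ?dot_ge0// lerDr.
Unshelve. all: by end_near. Qed.

End cvg_dot.

Section first_eigenvalue.
Variables (R : realType) (n : nat) (Omega : set 'rV[R]_n).
Hypothesis oO : open Omega.
Local Notation E := 'rV[R]_n.
Implicit Types (phi : E -> R) (g : 'I_n -> E -> R) (lam : R).

Let mO : measurable Omega. Proof. exact: open_measurable_rV. Qed.

(** By density, an eigenfunction may be tested against any function that is a
limit of test functions. *)
Lemma weak_form_extends phi g lam phi' g' :
  L2 Omega phi -> (forall i, L2 Omega (g i)) ->
  (forall psi, test_function Omega psi ->
    \sum_(i < n) ip Omega (g i) (partial i psi) = lam * ip Omega phi psi) ->
  in_closure_test Omega phi' g' ->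
  \sum_(i < n) ip Omega (g i) (g' i) = lam * ip Omega phi phi'.
Proof.
move=> L2phi L2g weak [L2phi' L2g' [psi [tpsi psiphi psig]]].
have mpsi k : measurable_fun Omega (psi k).
  apply: measurable_funTS; apply: continuous_measurable_rV.
  by have [/(_ [::])[]] := tpsi k.
have mdpsi i k : measurable_fun Omega (partial i (psi k)).
  apply: measurable_funTS; apply: continuous_measurable_rV.
  by have [/(_ [:: i])[]] := tpsi k.
have c1 : \sum_(i < n) ip Omega (g i) (partial i (psi k)) @[k --> \oo] -->
    \sum_(i < n) ip Omega (g i) (g' i).
  apply: cvg_big => [|i _]; first exact: add_continuous.
  exact: (cvg_dot mO (L2g i) (L2g' i) (mdpsi i) (psig i)).
have c2 : \sum_(i < n) ip Omega (g i) (partial i (psi k)) @[k --> \oo] -->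
    lam * ip Omega phi phi'.
  under eq_fun do rewrite weak//.
  apply: cvgM; first exact: cvg_cst.
  exact: (cvg_dot mO L2phi L2phi' mpsi psiphi).
exact: cvg_unique c1 c2.
Qed.

(** Both sides equal the symmetric expression sum of ip (g i) (g' i): this is
the self-adjointness of the Dirichlet Laplacian. *)
Lemma eigenpair_exchange phi lam phi' lam' :
  dirichlet_eigenpair Omega phi lam -> dirichlet_eigenpair Omega phi' lam' ->
  lam * ip Omega phi phi' = lam' * ip Omega phi phi'.
Proof.
move=> [g [cg wg]] [g' [cg' wg']].
have [Lphi Lg _] := cg; have [Lphi' Lg' _] := cg'.
rewrite -(weak_form_extends Lphi Lg wg cg') [ip _ phi phi']dotC.
rewrite -(weak_form_extends Lphi' Lg' wg' cg).
by apply: eq_bigr => i _; exact: dotC.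
Qed.

(** The first eigenfunction of the second basis has a nonzero coefficient on
some phi k, since its expansion would otherwise vanish; then
lam' 0 = lam k >= lam 0. *)
Lemma first_eigenvalue_le (phi phi' : nat -> E -> R) (lam lam' : nat -> R) :
  dirichlet_eigenbasis Omega phi lam -> dirichlet_eigenbasis Omega phi' lam' ->
  lam 0 <= lam' 0.
Proof.
move=> [eig _ expand _ [ndlam _]] [eig' orth' _ _ _].
have Lphi' : L2 Omega (phi' 0) by have [g [[]]] := eig' 0.
have [k nz] : exists k, ip Omega (phi' 0) (phi k) != 0.
  apply: contrapT => /forallNP z.
  have {}z k : ip Omega (phi' 0) (phi k) = 0.
    by apply/eqP; apply: contrapT => /negP; exact: z.
  have := expand _ Lphi'; rewrite /cvg_L2.
  have := integral_sqr mO Lphi'.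
  rewrite -[dot _ _ _ _]/(ip _ _ _) orth' eqxx => I1.
  under eq_fun => N.
    under eq_integral => x _.
      rewrite big1 => [|i _]; last by rewrite z mul0r.
      rewrite sub0r sqrrN; over.
    rewrite I1; over.
  move=> /(cvg_unique (@ereal_hausdorff R) (cvg_cst _))/eqP.
  by rewrite eqe oner_eq0.
have := eigenpair_exchange (eig' 0) (eig k) => /(mulIf nz) ->.
exact: ndlam.
Qed.

End first_eigenvalue.

(** * Independence of the past and the present *)

Section independent_factor.
Context d d' (Xi : measurableType d) (T : measurableType d') (R : realType).
Variables (mu : probability Xi R) (X : {RV mu >-> T}) (Y : {RV mu >-> R}).
Hypothesis indepXY : forall A B, measurable A -> measurable B ->
  mu (X @^-1` A `&` Y @^-1` B) = (mu (X @^-1` A) * mu (Y @^-1` B))%E.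

(** The law of (X, Y) is the product of the two laws, so Fubini integrates Y
out first. *)
Lemma expectation_indep_centered (g : T -> R) :
  measurable_fun [set: T] g ->
  mu.-integrable [set: Xi] (EFin \o Y) -> ('E_mu[Y] = 0)%E ->
  mu.-integrable [set: Xi] (EFin \o (fun xi => g (X xi) * Y xi)) ->
  (\int[mu]_xi (g (X xi) * Y xi)%:E = 0)%E.
Proof.
move=> mg iY EY0 igXY.
pose XY xi := (X xi, Y xi).
have mXY : measurable_fun [set: Xi] XY.
  by apply: measurable_fun_pair; exact: measurable_funP.
pose f (p : T * R) : \bar R := (g p.1 * p.2)%:E.
have mf : measurable_fun [set: T * R] f.
  apply/measurable_EFinP; apply: measurable_funM => //.
  exact: measurableT_comp.
pose m1 := distribution mu X; pose m2 := distribution mu Y.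
have lawXY S : measurable S -> (m1 \x m2)%E S = pushforward mu XY S.
  by apply: (@product_measure_unique _ _ _ _ _ m1 m2 (pushforward mu XY)).
have ipush : (pushforward mu XY).-integrable [set: T * R] f.
  by apply: integrable_pushforward.
have iprod : (m1 \x m2)%E.-integrable [set: T * R] f.
  move/integrableP : ipush => [_ fty]; apply/integrableP; split => //.
  rewrite (eq_measure_integral (pushforward mu XY))// => S mS _.
  exact: lawXY.
transitivity (\int[pushforward mu XY]_p f p)%E.
  by rewrite integral_pushforward.
transitivity (\int[m1 \x m2]_p f p)%E.
  by apply: eq_measure_integral => S mS _; exact/esym/lawXY.
rewrite -integral12_prod_meas1// integral0_eq// => x _.
rewrite /fubini_F /f/=.
under eq_integral do rewrite EFinM.
rewrite integralZl//; last exact: integrable_pushforward.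
rewrite integral_distribution// -[X in (_ * X)%E]/(\int[mu]_xi (Y xi)%:E)%E.
by move: EY0; rewrite unlock => ->; rewrite mule0.
Qed.
End independent_factor.

(** Mutual independence is a statement about finitely many events of single
variables, that is about boxes; it extends to all Borel events of the vector of
the first N variables because boxes determine a measure. *)
Section past.
Context d (Xi : measurableType d) (R : realType) (mu : probability Xi R).
Variable w : nat -> {RV mu >-> R}.

Definition past N (xi : Xi) : 'rV[R]_N := \row_(i < N) w i xi.

Lemma measurable_past N : measurable_fun [set: Xi] (past N).
Proof.
apply: measurable_fun_rV => i; under eq_fun do rewrite mxE.
exact: measurable_funP.
Qed.

HB.instance Definition _ N := isMeasurableFun.Build _ _ _ _ (past N)
  (@measurable_past N).

Hypothesis indep : mutually_independent w.

Lemma past_independent N (A : set 'rV[R]_N) (B : set R) :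
  measurable A -> measurable B ->
  mu (past N @^-1` A `&` w N @^-1` B) =
  (mu (past N @^-1` A) * mu (w N @^-1` B))%E.
Proof.
move=> mA mB; have mwB : measurable (w N @^-1` B).
  by rewrite -[X in measurable X]setTI; exact: measurable_funP.
have pB0 : 0 <= fine (mu (w N @^-1` B)) by exact/fine_ge0/measure_ge0.
pose m1 := pushforward (mrestr mu mwB) (past N).
pose m2 := mscale (NngNum pB0) (distribution mu (past N)).
suff : m1 A = m2 A.
  rewrite /m1 /m2 /mscale /distribution /pushforward /mrestr/=.
  by rewrite fineK ?fin_num_measure// muleC.
apply: (@measure_unique _ _ _ (@rV_boxes R N) (fun=> setT)) => //.
- exact: measurable_rV_boxesE.
- exact: rV_boxesI.
- by move=> _; exact: rV_boxesT.
- by rewrite bigcup_const.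
- move=> _ [C [mC ->]].
  change (mu (past N @^-1` [set x : 'rV[R]_N | forall i : 'I_N, C i (x ord0 i)]
      `&` w N @^-1` B) = (fine (mu (w N @^-1` B)))%:E *
    mu (past N @^-1` [set x : 'rV[R]_N | forall i : 'I_N, C i (x ord0 i)]))%E.
  rewrite fineK ?fin_num_measure//.
  (* The box on the past and the event on w N, as one family of events. *)
  pose B' (k : nat) := if k == N then B else C k.
  have mB' k : measurable (B' k) by rewrite /B'; case: ifP.
  have B'C k : (k < N)%N -> B' k = C k by rewrite /B' => kN; rewrite ltn_eqF.
  have preE s : \bigcap_(k in [set` s]) (w k @^-1` B' k) =
      [set xi | forall k, k \in s -> B' k (w k xi)] by [].
  have := indep (iota_uniq 0 N.+1) (fun k _ => mB' k).
  have := indep (iota_uniq 0 N) (fun k _ => mB' k).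
  rewrite -(addn1 N) iotaD big_cat/= big_seq1 => <-.
  have -> : past N @^-1` [set x | forall i : 'I_N, C i (x ord0 i)] =
      \bigcap_(k in [set` iota 0 N]) (w k @^-1` B' k).
    apply/seteqP; split => xi /= Cx.
      move=> k /=; rewrite mem_iota add0n => kN; rewrite B'C//.
      by have := Cx (Ordinal kN); rewrite mxE.
    move=> i; rewrite mxE -B'C//; apply: Cx.
    by rewrite /= mem_iota add0n/=.
  have -> : w N @^-1` B = w N @^-1` B' N by rewrite /B' eqxx.
  rewrite add0n muleC => <-; congr (mu _).
  apply/seteqP; split => xi /=.
    move=> [Cx Bx] k /=; rewrite mem_cat => /orP[|]; first exact: Cx.
    by rewrite inE => /eqP ->.
  move=> BCx; split.
    by move=> k /= kN; apply: BCx; rewrite /= mem_cat kN.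
  by apply: BCx; rewrite /= mem_cat inE eqxx orbT.
- by move=> _; rewrite /m1/= /pushforward /mrestr preimage_setT setTI
     -ge0_fin_numE ?fin_num_measure.
Qed.

End past.

(** * Martingale transforms of white noise *)

Section martingale_transform.
Variable R : realType.
Implicit Types (theta : nat -> R -> R) (x : nat -> R).

(** The increment at time N is x N multiplied by a factor that depends on the
current value only.  Constant factors give weighted partial sums; factors that
vanish beyond a threshold give partial sums frozen at their first crossing. *)
Fixpoint transform theta x N : R :=
  if N is N'.+1 then
    let y := transform theta x N' in y + theta N' y * x N'
  else 0.

Lemma eq_transform theta x x' N : (forall k, (k < N)%N -> x k = x' k) ->
  transform theta x N = transform theta x' N.
Proof.
elim: N => //= N ih xx'; rewrite ih; last by move=> k kN; exact/xx'/ltnW.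
by rewrite xx'.
Qed.

Lemma transform_cst (b x : nat -> R) N :
  transform (fun k _ => b k) x N = \sum_(k < N) b k * x k.
Proof. by elim: N => [|N ih] /=; rewrite ?big_ord0// big_ord_recr ih. Qed.

Lemma measurable_transform d (T : measurableType d) theta
    (x : nat -> T -> R) N :
  (forall k, measurable_fun [set: R] (theta k)) ->
  (forall k, measurable_fun [set: T] (x k)) ->
  measurable_fun [set: T] (fun t => transform theta (x^~ t) N).
Proof.
move=> mtheta mx; elim: N => [|N ih] //=.
apply: measurable_funD => //; apply: measurable_funM => //.
exact: measurableT_comp.
Qed.

Definition stop_at (eps : R) (b : nat -> R) : nat -> R -> R :=
  fun k y => if `|y| < eps then b k else 0.

(** The frozen sum agrees with the plain one up to the first crossing and keeps
its value from then on, so its terminal value remembers that a crossing took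
place. *)
Lemma stop_at_crossed eps (b : nat -> R) x k N : 0 < eps -> (k <= N)%N ->
  eps <= `|\sum_(i < k) b i * x i| -> eps <= `|transform (stop_at eps b) x N|.
Proof.
move=> eps0 kN; pose S j := \sum_(i < j) b i * x i.
rewrite -/(S k); set Z := transform _ _.
suff : eps <= `|Z N| \/
    (Z N = S N /\ forall j, (j <= N)%N -> `|S j| < eps).
  move=> [//|[_ /(_ _ kN)]]; by move=> /lt_le_trans h /h; rewrite ltxx.
elim: N {k kN} => [|N [ih|[ZS ih]]].
- right; rewrite /Z/= /S big_ord0; split=> // j; rewrite leqn0 => /eqP ->.
  by rewrite big_ord0 normr0.
- by left; rewrite /Z/= -/Z/= /stop_at -/(Z N) ltNge ih/= mul0r addr0.
- have ZS' : Z N.+1 = S N.+1.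
    rewrite /Z/= -/(Z N) /stop_at ZS ih// /S big_ord_recr//=.
  have [|lt_eps] := leP eps `|Z N.+1|; first by left.
  right; split=> // j; rewrite leq_eqVlt => /predU1P[->|]; last exact: ih.
  by rewrite -ZS'.
Qed.

Lemma stop_at_absorbed eps (b : nat -> R) x N M : (N <= M)%N ->
  eps <= `|transform (stop_at eps b) x N| ->
  eps <= `|transform (stop_at eps b) x M|.
Proof.
move=> /subnK <-; elim: (M - N)%N => [//|j ih] /ih {}ih; rewrite addSn /=.
by rewrite /stop_at ltNge -/(stop_at _ _) ih/= mul0r addr0.
Qed.

End martingale_transform.

Section white_noise.
Context d (Xi : measurableType d) (R : realType) (mu : probability Xi R).
Variable w : nat -> {RV mu >-> R}.
Hypothesis wn : white_noise w.

(** The hypothesis on the variance alone yields square-integrability: the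
centred square has integral 1, and the mean is 0. *)
Lemma integral_noise_sqr k : (\int[mu]_xi (w k xi ^+ 2)%:E = 1)%E.
Proof.
have [_ E0 /(_ k)] := wn; rewrite /variance unlock E0 unlock => <-.
apply: eq_integral => xi _; rewrite expr2.
by congr (_ * _)%:E; rewrite /= subr0.
Qed.

Lemma sqi_noise k : sq_integrable mu setT (w k).
Proof.
apply: integral_sqr_lty => //.
by rewrite integral_noise_sqr ltry.
Qed.

Lemma dot_noise k : dot mu setT (w k) (w k) = 1.
Proof.
have := integral_sqr measurableT (sqi_noise k); rewrite integral_noise_sqr => h.
by apply: EFin_inj; rewrite -h.
Qed.

Lemma sqi1 : sq_integrable mu setT (fun=> 1).
Proof.
split=> //; have : mu.-integrable setT (EFin \o cst (1 : R)).
  exact: finite_measure_integrable_cst.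
by apply: eq_integrable => // x _; rewrite /= expr1n.
Qed.

Lemma integrable_noise k : mu.-integrable setT (EFin \o w k).
Proof.
have := sqi_mul measurableT (sqi_noise k) sqi1.
by apply: eq_integrable => // x _ /=; rewrite mulr1.
Qed.

Section second_moment.
Variables (theta : nat -> R -> R) (b : nat -> R).
Hypothesis mtheta : forall k, measurable_fun [set: R] (theta k).
Hypothesis theta_le : forall k y, `|theta k y| <= `|b k|.

Let Y N xi := transform theta (fun k => w k xi) N.
Let step N xi := theta N (Y N xi) * w N xi.

Let mY N : measurable_fun [set: Xi] (Y N).
Proof. by apply: measurable_transform => // k; exact: measurable_funP. Qed.

Let theta_sqr_le k y : theta k y ^+ 2 <= b k ^+ 2.
Proof.
rewrite -(real_normK (num_real (theta k y))) -(real_normK (num_real (b k))).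
by rewrite lerXn2r ?nnegrE.
Qed.

Let sqi_step N : sq_integrable mu setT (step N).
Proof.
have mstep : measurable_fun setT (step N).
  by apply: measurable_funM; [exact: measurableT_comp|exact: measurable_funP].
split=> //; have [_ ibw] := sqiZ measurableT (b N) (sqi_noise N).
apply: le_integrable ibw => //.
  by apply/measurable_EFinP; exact: measurable_funX.
move=> xi _ /=; rewrite lee_fin !ger0_norm ?sqr_ge0// !exprMn.
by rewrite ler_wpM2r ?sqr_ge0.
Qed.

Lemma sqi_transform N : sq_integrable mu setT (Y N).
Proof.
elim: N => [|N ih]; first exact: sqi0.
exact: (sqiD measurableT ih (sqi_step N)).
Qed.

(** Martingale orthogonality: Y N and its factor are functions of the first N
variables, and the increment carries the extra factor w N, which is
independent of them and centred. *)
Let dot_Y_step N : dot mu setT (Y N) (step N) = 0.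
Proof.
pose x (v : 'rV[R]_N) k := if insub k is Some i then v ord0 i else 0.
have xpast xi k : (k < N)%N -> w k xi = x (past w N xi) k.
  by move=> kN; rewrite /x insubT mxE.
pose y v := transform theta (x v) N.
have yE xi : Y N xi = y (past w N xi) by apply: eq_transform => k; exact: xpast.
have my : measurable_fun [set: 'rV[R]_N] y.
  apply: (@measurable_transform _ _ _ theta (fun k v => x v k)) => // k.
  by rewrite /x; case: insubP => [i _ _|_] //; exact: measurable_coor.
have dotE : dot mu setT (Y N) (step N) =
    fine (\int[mu]_xi (y (past w N xi) * theta N (y (past w N xi)) *
      w N xi)%:E)%E.
  by congr fine; apply: eq_integral => xi _; rewrite /step !yE mulrA.
rewrite dotE.
rewrite (@expectation_indep_centered _ _ _ _ _ mu (past w N) (w N) _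
  (fun v => y v * theta N (y v)))//.
- by move=> A B mA mB; apply: past_independent => //; case: wn.
- by apply: measurable_funM => //; exact: measurableT_comp.
- exact: integrable_noise.
- by case: wn.
- have := sqi_mul measurableT (sqi_transform N) (sqi_step N).
  by apply: eq_integrable => // xi _; rewrite /= /step !yE mulrA.
Qed.

(** Pythagoras, by orthogonality of the increment. *)
Lemma dot_transformS N :
  dot mu setT (Y N.+1) (Y N.+1) = dot mu setT (Y N) (Y N) +
    dot mu setT (step N) (step N).
Proof.
have := dot_sqrD measurableT (sqi_transform N) (sqi_step N).
by rewrite dot_Y_step mulr0 addr0.
Qed.

Let dot_step_le N : dot mu setT (step N) (step N) <= b N ^+ 2.
Proof.
rewrite -lee_fin -integral_sqr//.
have -> : (b N ^+ 2)%:E = (\int[mu]_xi ((b N * w N xi) ^+ 2)%:E)%E.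
  rewrite integral_sqr//; last exact/sqiZ/sqi_noise.
  by rewrite (dotZ measurableT _ (sqi_noise N)) dot_noise mulr1.
apply: ge0_le_integral => //.
- by move=> xi _; rewrite lee_fin sqr_ge0.
- by apply/measurable_EFinP/measurable_funX; case: (sqi_step N).
- by apply/measurable_EFinP/measurable_funX; apply: measurable_funM.
- by move=> xi _ /=; rewrite lee_fin !exprMn ler_wpM2r ?sqr_ge0.
Qed.

Lemma dot_transform_le N :
  dot mu setT (Y N) (Y N) <= \sum_(k < N) b k ^+ 2.
Proof.
elim: N => [|N ih]; last by rewrite dot_transformS big_ord_recr lerD.
by rewrite big_ord0 dot0.
Qed.

End second_moment.

Lemma dot_noise_sum (b : nat -> R) N :
  dot mu setT (fun xi => \sum_(k < N) b k * w k xi)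
    (fun xi => \sum_(k < N) b k * w k xi) = \sum_(k < N) b k ^+ 2.
Proof.
pose Y xi := transform (fun k _ => b k) (fun k => w k xi).
have YE N' : (fun xi => \sum_(k < N') b k * w k xi) = Y^~ N'.
  by apply/funext => xi; rewrite /Y transform_cst.
rewrite YE; elim: N {YE} => [|N ih].
  by rewrite big_ord0 dot0.
rewrite (@dot_transformS (fun k _ => b k) b)// ih big_ord_recr/=; congr +%R.
by rewrite (dotZ measurableT _ (sqi_noise N)) dot_noise// mulr1.
Qed.

End white_noise.

(** * Almost sure convergence of random series *)

Section random_series.
Context d (Xi : measurableType d) (R : realType) (mu : probability Xi R).
Variable w : nat -> {RV mu >-> R}.
Hypothesis wn : white_noise w.

(** Written with the frozen sums, for which these events increase with N. *)
Definition crosses (eps : R) (b : nat -> R) : set Xi :=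
  \bigcup_N [set xi | eps <= `|transform (stop_at eps b) (fun k => w k xi) N|].

Lemma measurable_stop_at eps b k : measurable_fun [set: R] (stop_at eps b k).
Proof.
by apply: measurable_fun_if => //; apply: measurable_fun_ltr.
Qed.

Let measurable_crossed eps b N : measurable
  [set xi | eps <= `|transform (stop_at eps b) (fun k => w k xi) N|].
Proof.
rewrite -[X in measurable X]setTI.
rewrite (_ : [set xi | _] = (fun xi => `|transform (stop_at eps b)
    (fun k => w k xi) N|) @^-1` `[eps, +oo[%classic); last first.
  by apply/seteqP; split=> xi /=; rewrite in_itv/= andbT.
have : measurable_fun [set: Xi] (fun xi => `|transform (stop_at eps b)
    (fun k => w k xi) N|).
  apply: measurableT_comp => //; apply: measurable_transform => k.
    exact: measurable_stop_at.
  exact: measurable_funP.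
by apply.
Qed.

Lemma measurable_crosses eps b : measurable (crosses eps b).
Proof. by apply: bigcupT_measurable. Qed.

(** Chebyshev's inequality for the frozen sum at time N bounds the probability
of a crossing before N; continuity from below lets N grow. *)
Lemma Kolmogorov_maximal (eps : R) (b : nat -> R) (V : R) : 0 < eps ->
  (forall N, \sum_(k < N) b k ^+ 2 <= V) ->
  (mu (crosses eps b) <= (V / eps ^+ 2)%:E)%E.
Proof.
move=> eps0 bV; pose Y N xi := transform (stop_at eps b) (fun k => w k xi) N.
pose G N := [set xi | eps <= `|Y N xi|].
have ndG : nondecreasing_seq G.
  by move=> N M NM; apply/subsetPset => xi; exact: stop_at_absorbed.
have cG := @nondecreasing_cvg_mu _ _ _ mu G (measurable_crossed eps b)
  (measurable_crosses eps b) ndG.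
have leb k y : `|stop_at eps b k y| <= `|b k|.
  by rewrite /stop_at; case: ifP => // _; rewrite normr0.
have mst := measurable_stop_at eps b.
rewrite -(cvg_lim _ cG)//; apply: lime_le.
  by apply/cvg_ex; exists (mu (crosses eps b)).
near=> N; rewrite /= EFinM -[leRHS]muleC.
rewrite -lee_pdivrMl ?invr_gt0 ?exprn_gt0// invrK.
have mY : measurable_fun [set: Xi] (Y N) by case: (sqi_transform wn mst leb N).
pose YN : {mfun Xi >-> R} :=
  HB.pack (Y N) (isMeasurableFun.Build _ _ _ _ (Y N) mY).
have := @markov _ _ _ mu YN (fun y => y ^+ 2) eps eps0.
have -> : [set x | (eps%:E <= `|(YN x)%:E|)%E] = G N.
  by apply/seteqP; split => xi /=; rewrite lee_fin.
move=> /(_ _ _ _)/le_trans; apply => //.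
- by move=> r _; rewrite sqr_ge0.
- by move=> x y; rewrite !nnegrE => x0 y0 xy; rewrite lerXn2r.
- rewrite unlock; under eq_integral do rewrite /= real_normK ?num_real//.
  rewrite (integral_sqr measurableT (sqi_transform wn mst leb N)) lee_fin.
  exact: le_trans (dot_transform_le wn mst leb N) (bV N).
Unshelve. all: by end_near. Qed.

(** The maximal inequality, applied to the series without its first m terms,
bounds the probability that the partial sums move by more than eps after time
m by the tail of the variances over eps ^ 2.  So almost surely, for every eps,
there is an m past which they move by less than eps, and they form a Cauchy
sequence. *)
Lemma random_series_cvg (a : nat -> R) :
  cvgn (fun N => \sum_(k < N) a k ^+ 2) ->
  {ae mu, forall xi, cvgn (fun N => \sum_(k < N) a k * w k xi)}.
Proof.
move=> ca; pose A N := \sum_(k < N) a k ^+ 2.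
(* Zeroing the first m coefficients makes the partial sums start at time m. *)
pose b m k := if (k < m)%N then 0 else a k.
have ndA : nondecreasing_seq A.
  apply/nondecreasing_seqP => N; rewrite /A big_ord_recr/=.
  by rewrite lerDl sqr_ge0.
have bE m N (f : nat -> R) : (m <= N)%N ->
    \sum_(k < N) b m k * f k = \sum_(k < N) a k * f k - \sum_(k < m) a k * f k.
  move=> mN; rewrite -!(big_mkord xpredT (fun k => _ k * f k)).
  rewrite [X in _ = X - _](big_cat_nat (leq0n m) mN)/= addrAC subrr add0r.
  rewrite (big_cat_nat (leq0n m) mN)/= big_nat_cond big1 ?add0r.
    rewrite big_nat_cond [RHS]big_nat_cond; apply: eq_bigr => k.
    by rewrite andbT /b => /andP[mk _]; rewrite ltnNge mk.
  by move=> k; rewrite andbT /b => /andP[_ ->]; rewrite mul0r.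
have b0 m N (f : nat -> R) : (N <= m)%N -> \sum_(k < N) b m k * f k = 0.
  move=> Nm; rewrite big1// => k _; rewrite /b ifT ?mul0r//.
  exact: leq_trans Nm.
have bA m N : \sum_(k < N) b m k ^+ 2 <= limn A - A m.
  have -> : \sum_(k < N) b m k ^+ 2 = \sum_(k < N) b m k * b m k.
    by apply: eq_bigr => k _; rewrite expr2.
  have [mN|/ltnW Nm] := leqP m N; last first.
    rewrite b0// subr_ge0; exact: nondecreasing_cvgn_le.
  have -> : \sum_(k < N) b m k * b m k = \sum_(k < N) b m k * a k.
    by apply: eq_bigr => k _; rewrite /b; case: ifP; rewrite ?mul0r.
  rewrite bE//.
  have AE M : \sum_(k < M) a k * a k = A M.
    by apply: eq_bigr => k _; rewrite expr2.
  by rewrite !AE lerD2r; exact: nondecreasing_cvgn_le.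
pose e (p : nat) : R := p.+1%:R^-1.
pose bad := \bigcup_p \bigcap_m crosses (e p) (b m).
have bad0 : mu.-negligible bad.
  apply: negligible_bigcup => p; apply/negligibleP.
    by apply: bigcapT_measurable => m; exact: measurable_crosses.
  apply/eqP; rewrite -measure_le0; apply/lee_addgt0Pr => _/posnumP[eps].
  rewrite add0e.
  have : (limn A - A m) / e p ^+ 2 @[m --> \oo] -->
      (limn A - limn A) / e p ^+ 2.
    by apply: cvgM; [apply: cvgB => //|]; exact: cvg_cst.
  rewrite subrr mul0r => /cvgrPdist_le/(_ eps%:num)[]// m _ /(_ m (leqnn m)) hm.
  apply: (@le_trans _ _ (mu (crosses (e p) (b m)))).
    apply: le_measure; rewrite ?inE; [|exact: measurable_crosses|].
      by apply: bigcapT_measurable => j; exact: measurable_crosses.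
    by move=> xi /(_ m); apply.
  apply: (le_trans (Kolmogorov_maximal _ (bA m))); first by rewrite invr_gt0.
  rewrite lee_fin (le_trans (ler_norm _))//.
  by rewrite -normrN; move: hm; rewrite sub0r.
apply: negligibleS bad0 => xi /= nc; apply: contrapT => nbad; apply: nc.
apply/cauchy_cvgP/cauchy_exP => eps eps0.
have [p pe] : exists p, e p < eps.
  exists (Num.truncn eps^-1); rewrite /e invf_plt ?posrE//; exact: truncnS_gt.
have [m nm] : exists m, ~ crosses (e p) (b m) xi.
  by apply/existsNP => h; apply: nbad; exists p => // m _; exact: h.
exists (\sum_(k < m) a k * w k xi); exists m => // N /= mN.
rewrite /ball/= distrC -(bE m N (fun k => w k xi))//.
apply: lt_trans pe; rewrite ltNge; apply/negP => cr; apply: nm.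
by exists N => //=; apply: (stop_at_crossed _ (leqnn N) cr); rewrite invr_gt0.
Qed.

End random_series.

(** * The dual norm in terms of the eigenbasis *)

Lemma weighted_CauchySchwarz (R : realFieldType) (r c lam : nat -> R) N :
  (forall k, 0 < lam k) ->
  (\sum_(k < N) c k * r k) ^+ 2 <=
    (\sum_(k < N) r k ^+ 2 / lam k) * (\sum_(k < N) lam k * c k ^+ 2).
Proof.
move=> lam0; apply: discr_le => [||t].
- by apply: sumr_ge0 => k _; rewrite divr_ge0 ?sqr_ge0 ?ltW.
- by apply: sumr_ge0 => k _; rewrite mulr_ge0 ?sqr_ge0 ?ltW.
- rewrite !mulr_sumr -!big_split/=; apply: sumr_ge0 => k _.
  have -> : r k ^+ 2 / lam k + 2 * t * (c k * r k) +
      t ^+ 2 * (lam k * c k ^+ 2) = (r k + t * lam k * c k) ^+ 2 / lam k.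
    by field; exact: lt0r_neq0.
  by rewrite divr_ge0 ?sqr_ge0 ?ltW.
Qed.

Section dual_norm.
Variables (R : realType) (n : nat) (Omega : set 'rV[R]_n).
Hypothesis oO : open Omega.
Local Notation E := 'rV[R]_n.
Variables (phi : nat -> E -> R) (lam : nat -> R).
Hypothesis basis : dirichlet_eigenbasis Omega phi lam.

Let mO : measurable Omega. Proof. exact: open_measurable_rV. Qed.

Lemma eigenvalue_ge k : lam 0 <= lam k.
Proof. by case: basis => _ _ _ _ [+ _]; exact. Qed.

Lemma eigenvalue_gt0 k : 0 < lam k.
Proof. by apply: lt_le_trans (eigenvalue_ge k); case: basis. Qed.

Lemma L2_eigenfunction k : L2 Omega (phi k).
Proof. by have [/(_ k)[g [[]]]] := basis. Qed.

Lemma energy_ge0 (u : E -> R) k :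
  (0 <= (lam k * `|ip Omega u (phi k)| ^+ 2)%:E)%E.
Proof. by rewrite lee_fin mulr_ge0 ?sqr_ge0// ltW// eigenvalue_gt0. Qed.

Lemma H01_sqnormE u N : (forall k, (N <= k)%N -> ip Omega u (phi k) = 0) ->
  H01_sqnorm Omega phi lam u =
  (\sum_(k < N) lam k * ip Omega u (phi k) ^+ 2)%:E.
Proof.
move=> u0; rewrite /H01_sqnorm (nneseries_split 0 N); last first.
  by move=> k _; exact: energy_ge0.
rewrite add0n eseries0 ?adde0 => [|k Nk _]; last first.
  by rewrite u0// normr0 expr0n mulr0.
rewrite big_mkord sumEFin; congr EFin; apply: eq_bigr => k _.
by rewrite real_normK// num_real.
Qed.

Definition combo (c : nat -> R) N : E -> R :=
  fun x => \sum_(k < N) c k * phi k x.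

Lemma L2_combo c N : L2 Omega (combo c N).
Proof.
apply: (@sqi_sum _ _ _ (lebesgue_rV R n) Omega mO _ _
  (fun (k : 'I_N) x => c k * phi k x)) => k.
exact: (sqiZ mO (c k) (L2_eigenfunction k)).
Qed.

Lemma ip_combo c N j :
  ip Omega (combo c N) (phi j) = if (j < N)%N then c j else 0.
Proof.
have Lk (k : 'I_N) := sqiZ mO (c k) (L2_eigenfunction k).
transitivity (\sum_(k < N) ip Omega (fun x => c k * phi k x) (phi j)).
  exact: (dot_suml mO _ Lk (L2_eigenfunction j)).
have e (k : 'I_N) : ip Omega (fun x => c k * phi k x) (phi j) =
    c k * (k == j :> nat)%:R.
  have [_ orth _ _ _] := basis; rewrite -orth.
  exact: (dotZl mO (c k) (L2_eigenfunction k) (L2_eigenfunction j)).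
rewrite (eq_bigr _ (fun k _ => e k)); case: ifPn => [jN|Nj].
  rewrite (bigD1 (Ordinal jN))//= eqxx mulr1 big1 ?addr0// => k kj.
  rewrite (_ : (k == j :> nat) = false) ?mulr0//.
  by apply: contraNF kj => /eqP kj; apply/eqP/val_inj.
rewrite big1// => k _; rewrite (_ : (k == j :> nat) = false) ?mulr0//.
by apply: contraNF Nj => /eqP <-.
Qed.

Lemma H01_sqnorm_combo c N :
  H01_sqnorm Omega phi lam (combo c N) = (\sum_(k < N) lam k * c k ^+ 2)%:E.
Proof.
rewrite (@H01_sqnormE _ N) => [|k Nk]; last by rewrite ip_combo ltnNge Nk.
by congr EFin; apply: eq_bigr => k _; rewrite ip_combo ltn_ord.
Qed.

Lemma H01_combo c N : H01 Omega phi lam (combo c N).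
Proof. by split; [exact: L2_combo|rewrite H01_sqnorm_combo ltry]. Qed.

Lemma eigenfunction_combo k : phi k = combo (fun j => (j == k)%:R) k.+1.
Proof.
apply/funext => x; rewrite /combo big_ord_recr/= eqxx mul1r.
by rewrite big1 ?add0r// => j _; rewrite ltn_eqF// mul0r.
Qed.

Lemma H01_eigenfunction k : H01 Omega phi lam (phi k).
Proof. by rewrite eigenfunction_combo; exact: H01_combo. Qed.

Variable l : (E -> R) -> R.
Hypothesis Hl : Hm1 Omega phi lam l.

(** Functionals are only known to satisfy l (a u + v) = a l u + l v, so the
empty combination needs the instance a = -1, u = v = 0. *)
Lemma Hm1_combo c N : l (combo c N) = \sum_(k < N) c k * l (phi k).
Proof.
have [lin _] := Hl; elim: N => [|N ih].
  have := lin (-1) _ _ (H01_combo c 0) (H01_combo c 0).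
  rewrite mulN1r addNr big_ord0 => <-; congr l; apply/funext => x.
  by rewrite /combo big_ord0 mulr0 addr0.
rewrite big_ord_recr/= -ih addrC.
rewrite -lin; [|exact: H01_eigenfunction|exact: H01_combo].
by congr l; apply/funext => x; rewrite /combo big_ord_recr/= addrC.
Qed.

(** Partial sums of the squared dual norm. *)
Definition dual_sum N : R := \sum_(k < N) l (phi k) ^+ 2 / lam k.

Lemma dual_sum_ge0 N : 0 <= dual_sum N.
Proof.
by apply: sumr_ge0 => k _; rewrite divr_ge0 ?sqr_ge0// ltW// eigenvalue_gt0.
Qed.

(** Truncations of the Riesz representative of l in H01; they nearly attain the
dual norm, as l (riesz N) and the squared norm of riesz N are both
[dual_sum N]. *)
Definition riesz N : E -> R := combo (fun k => l (phi k) / lam k) N.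

Lemma Hm1_riesz N : l (riesz N) = dual_sum N.
Proof.
rewrite Hm1_combo; apply: eq_bigr => k _; rewrite expr2.
by rewrite mulrAC.
Qed.

Lemma H01_norm_riesz N :
  H01_norm Omega phi lam (riesz N) = Num.sqrt (dual_sum N).
Proof.
rewrite /H01_norm H01_sqnorm_combo/=; congr Num.sqrt.
by apply: eq_bigr => k _; field; exact/lt0r_neq0/eigenvalue_gt0.
Qed.

(** Testing l on [riesz N] gives q <= M * sqrt q for q = [dual_sum N]. *)
Lemma dual_sum_le (M : R) : (forall u, H01 Omega phi lam u ->
    `|l u| <= M * H01_norm Omega phi lam u) ->
  forall N, dual_sum N <= M ^+ 2.
Proof.
move=> lM N; have := lM _ (H01_combo (fun k => l (phi k) / lam k) N).
rewrite -/(riesz N) Hm1_riesz H01_norm_riesz ger0_norm ?dual_sum_ge0//.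
set q := dual_sum N; have q0 : 0 <= q := dual_sum_ge0 N.
have [->|q_neq0] := eqVneq q 0; first by rewrite sqr_ge0.
have sq0 : 0 < Num.sqrt q by rewrite sqrtr_gt0 lt_neqAle eq_sym q_neq0.
rewrite -{1}(sqr_sqrtr q0) expr2 ler_pM2r// => sM.
by rewrite -(sqr_sqrtr q0) lerXn2r// nnegrE ?(le_trans _ sM)// ltW.
Qed.

Lemma nondecreasing_dual_sum : nondecreasing_seq dual_sum.
Proof.
apply/nondecreasing_seqP => N; rewrite /dual_sum big_ord_recr/= lerDl.
by rewrite divr_ge0 ?sqr_ge0// ltW// eigenvalue_gt0.
Qed.

Lemma is_cvg_dual_sum : cvgn dual_sum.
Proof.
have [_ [M lM]] := Hl; apply: nondecreasing_is_cvgn.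
  exact: nondecreasing_dual_sum.
by exists (M ^+ 2) => _ [N _ <-]; exact: dual_sum_le.
Qed.

Lemma dual_sum_le_lim N : dual_sum N <= limn dual_sum.
Proof.
exact: (nondecreasing_cvgn_le nondecreasing_dual_sum is_cvg_dual_sum).
Qed.

Let remainder v N : E -> R :=
  fun x => v x - combo (fun k => ip Omega v (phi k)) N x.

Let H01_sqnorm_remainder v N : L2 Omega v ->
  (H01_sqnorm Omega phi lam (remainder v N) =
   \sum_(N <= k <oo) (lam k * `|ip Omega v (phi k)| ^+ 2)%:E)%E.
Proof.
move=> Lv.
have ipE k : ip Omega (remainder v N) (phi k) =
    if (k < N)%N then 0 else ip Omega v (phi k).
  have := dotBl mO Lv (L2_combo (fun k => ip Omega v (phi k)) N)
    (L2_eigenfunction k).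
  rewrite -![dot _ _ _ _]/(ip _ _ _) => ->; rewrite ip_combo.
  by case: ifP; rewrite ?subrr ?subr0.
rewrite /H01_sqnorm (nneseries_split 0 N); last first.
  by move=> k _; exact: energy_ge0.
rewrite add0n big_nat_cond big1 ?add0e => [|k /andP[/andP[_ kN] _]]; last first.
  by rewrite ipE kN normr0 expr0n mulr0.
rewrite eseries_cond [RHS]eseries_cond; apply: eq_eseriesr => k /= Nk.
by rewrite ipE ltnNge Nk.
Qed.

(** On the truncated expansion of v this is the Cauchy-Schwarz inequality with
weights lam k; on the remainder, continuity of l leaves M times the square root
of a tail of the series for the norm of v, which tends to 0. *)
Lemma Hm1_le_dual_sum v : H01 Omega phi lam v ->
  `|l v| <= Num.sqrt (limn dual_sum) * H01_norm Omega phi lam v.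
Proof.
move=> [Lv nv]; have [lin [M lM]] := Hl.
pose t N := (\sum_(N <= k <oo) (lam k * `|ip Omega v (phi k)| ^+ 2)%:E)%E.
have term_ge0 := energy_ge0 v.
have t_cvg0 : Num.sqrt (fine (t N)) @[N --> \oo] --> 0.
  have : t N @[N --> \oo] --> 0%E by exact: nneseries_tail_cvg.
  move=> /fine_cvgP[_ t0]; rewrite -[X in _ --> X](@sqrtr0 R).
  by apply: (continuous_cvg _ _ t0); exact: sqrt_continuous.
have Hrem N : H01 Omega phi lam (remainder v N).
  split; first exact: (sqiB mO Lv (L2_combo _ N)).
  rewrite H01_sqnorm_remainder//; apply: le_lt_trans nv.
  rewrite /H01_sqnorm [leRHS](nneseries_split 0 N)//.
  by rewrite add0n leeDr// sume_ge0.
have nvE : H01_sqnorm Omega phi lam v = (fine (H01_sqnorm Omega phi lam v))%:E.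
  by rewrite fineK// ge0_fin_numE// nneseries_ge0.
have split_le N : `|l v| <=
    Num.sqrt (limn dual_sum) * H01_norm Omega phi lam v +
    M * Num.sqrt (fine (t N)).
  have -> : l v = l (combo (fun k => ip Omega v (phi k)) N) + l (remainder v N).
    rewrite -[X in X + _]mul1r -lin; [|exact: H01_combo|exact: Hrem].
    by congr l; apply/funext => x; rewrite mul1r addrC subrK.
  rewrite (le_trans (ler_normD _ _))// lerD//; last first.
    rewrite (le_trans (lM _ (Hrem N)))// /H01_norm H01_sqnorm_remainder//.
  rewrite -(ler_pXn2r (ltn0Sn 1)) ?nnegrE ?mulr_ge0 ?sqrtr_ge0//.
  rewrite real_normK ?num_real// exprMn.
  rewrite sqr_sqrtr; last exact: le_trans (dual_sum_ge0 0) (dual_sum_le_lim 0).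
  rewrite /H01_norm sqr_sqrtr; last by rewrite fine_ge0// nneseries_ge0.
  rewrite Hm1_combo.
  apply: le_trans (weighted_CauchySchwarz (fun k => l (phi k))
    (fun k => ip Omega v (phi k)) N eigenvalue_gt0) _.
  apply: ler_pM; rewrite ?dual_sum_ge0//.
  - by apply: sumr_ge0 => k _; rewrite mulr_ge0 ?sqr_ge0// ltW// eigenvalue_gt0.
  - exact: dual_sum_le_lim.
  - rewrite -lee_fin -nvE /H01_sqnorm [leRHS](nneseries_split 0 N)//.
    rewrite add0n -[leLHS]adde0 leeD ?nneseries_ge0//.
    rewrite big_mkord sumEFin lee_fin; apply: ler_sum => k _.
    by rewrite real_normK// num_real.
have : Num.sqrt (limn dual_sum) * H01_norm Omega phi lam v +
    M * Num.sqrt (fine (t N)) @[N --> \oo] -->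
    Num.sqrt (limn dual_sum) * H01_norm Omega phi lam v + M * 0.
  by apply: cvgD; [|apply: cvgM => //]; exact: cvg_cst.
rewrite mulr0 addr0 => cvgB; rewrite -(cvg_lim _ cvgB)//.
apply: limr_ge; first by apply/cvg_ex; eexists; exact: cvgB.
by near=> N; exact: split_le.
Unshelve. all: by end_near. Qed.

Lemma ae_zero_ip v k : L2 Omega v -> ae_eq_on Omega v (fun=> 0) ->
  ip Omega v (phi k) = 0.
Proof.
move=> [mv _] v0; rewrite /ip /Rintegral.
have [mphi _] := L2_eigenfunction k.
rewrite (ae_eq_integral (cst 0%E))//.
- by rewrite integral0.
- by apply/measurable_EFinP; exact: measurable_funM.
- by apply: filterS v0 => x v0 Ox; rewrite v0// mul0r.
Qed.

(** The upper bound is [Hm1_le_dual_sum], the lower bound comes from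
[riesz N]. *)
Lemma Hm1_normE : Hm1_norm Omega phi lam l = (Num.sqrt (limn dual_sum))%:E.
Proof.
have sQ0 : 0 <= Num.sqrt (limn dual_sum) by rewrite sqrtr_ge0.
have H01n_ge0 v : 0 <= H01_norm Omega phi lam v by rewrite sqrtr_ge0.
apply/eqP; rewrite eq_le; apply/andP; split.
  apply: ge_ereal_sup => _ [v [Hv _] <-]; rewrite lee_fin.
  have := Hm1_le_dual_sum Hv; have := H01n_ge0 v.
  rewrite le_eqVlt => /predU1P[<- _|nv0]; first by rewrite invr0 mulr0.
  by rewrite ler_pdivrMr.
have nzphi k : ~ ae_eq_on Omega (phi k) (fun=> 0).
  move=> /(ae_zero_ip k (L2_eigenfunction k)).
  by have [_ -> _ _ _] := basis; rewrite eqxx => /eqP; rewrite oner_eq0.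
have ge0 : (0 <= Hm1_norm Omega phi lam l)%E.
  apply: le_trans (ereal_sup_ubound _); last first.
    exists (phi 0); last by [].
    by split; [exact: H01_eigenfunction|exact: nzphi].
  by rewrite lee_fin divr_ge0.
case hE : (Hm1_norm Omega phi lam l) ge0 => [h| |//] ge0; last by rewrite leey.
rewrite !lee_fin in ge0 *.
have dual_le N : dual_sum N <= h ^+ 2.
  have := dual_sum_ge0 N; rewrite le_eqVlt => /predU1P[<-|q0].
    by rewrite sqr_ge0.
  have : ((Num.sqrt (dual_sum N))%:E <= h%:E)%E.
    rewrite -hE; apply: ereal_sup_ubound; exists (riesz N).
      split; first exact: H01_combo.
      move=> z; suff q_eq0 : dual_sum N = 0 by rewrite q_eq0 ltxx in q0.
      rewrite -Hm1_riesz Hm1_combo big1// => k _.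
      have := ae_zero_ip k (L2_combo _ N) z.
      by rewrite ip_combo ltn_ord => ->; rewrite mul0r.
    rewrite Hm1_riesz H01_norm_riesz ger0_norm ?(ltW q0)//.
    by rewrite -{1}(sqr_sqrtr (ltW q0)) expr2 mulfK// sqrtr_eq0 -ltNge.
  rewrite lee_fin => sh; rewrite -(sqr_sqrtr (ltW q0)).
  by rewrite lerXn2r// nnegrE ?sqrtr_ge0.
rewrite -[leRHS]ger0_norm// -sqrtr_sqr ler_wsqrtr//.
apply: limr_le; first exact: is_cvg_dual_sum.
by near=> N; exact: dual_le.
Unshelve. all: by end_near. Qed.

End dual_norm.

(** * Equivalence of the two norms *)

Lemma limn_le_scaled (R : realType) (k : R) (u v : nat -> R) :
  cvgn u -> cvgn v -> (forall N, u N <= k * v N) -> limn u <= k * limn v.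
Proof.
move=> cu cv uv; apply: (ler_cvg_to cu (cvgM (cvg_cst k) cv)).
exact: nearW.
Qed.

Section residual_under_noise.
Variables (R : realType) (n : nat) (Omega : set 'rV[R]_n).
Hypothesis oO : open Omega.
Local Notation E := 'rV[R]_n.
Variables (phi : nat -> E -> R) (lam : nat -> R).
Hypothesis basis : dirichlet_eigenbasis Omega phi lam.
Variable l : (E -> R) -> R.
Hypothesis Hl : Hm1 Omega phi lam l.
Context d (Xi : measurableType d) (mu : probability Xi R).
Variable w : nat -> {RV mu >-> R}.
Hypothesis wn : white_noise w.
Variable tau : R.
Hypothesis tau_gt0 : 0 < tau.

Let lam_gt0 := eigenvalue_gt0 basis.

(** The random number l (Phi w N) is the partial sum of a random series with
these coefficients. *)
Definition noise_coef k : R := tau * (Num.sqrt (1 + lam k))^-1 * l (phi k).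

Definition noise_sum N : R := \sum_(k < N) noise_coef k ^+ 2.

Lemma Hm1_Phi N xi :
  l (Phi phi lam tau w N xi) = \sum_(k < N) noise_coef k * w k xi.
Proof.
have -> : Phi phi lam tau w N xi =
    combo phi (fun k => tau * (Num.sqrt (1 + lam k))^-1 * w k xi) N.
  apply/funext => x; rewrite /Phi /combo mulr_sumr.
  by apply: eq_bigr => k _; rewrite !mulrA.
rewrite (Hm1_combo oO basis Hl); apply: eq_bigr => k _.
by rewrite /noise_coef mulrAC.
Qed.

Lemma mean_sq_noise_sum N : mean_sq phi lam tau w l N = (noise_sum N)%:E.
Proof.
rewrite /mean_sq unlock.
under eq_integral do rewrite Hm1_Phi real_normK ?num_real//.
rewrite (integral_sqr measurableT).
  by rewrite (dot_noise_sum wn noise_coef).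
apply: (@sqi_sum _ _ _ mu setT measurableT _ _
  (fun (k : 'I_N) xi => noise_coef k * w k xi)) => k.
exact: (sqiZ measurableT _ (sqi_noise wn k)).
Qed.

Lemma noise_coef_sqr k :
  noise_coef k ^+ 2 = tau ^+ 2 * (l (phi k) ^+ 2 / (1 + lam k)).
Proof.
rewrite /noise_coef !exprMn exprVn sqr_sqrtr ?addr_ge0//; last exact: ltW.
by rewrite mulrAC mulrA.
Qed.

(** Here 1 / (1 + lam k) <= 1 / lam k. *)
Lemma noise_sum_le N : noise_sum N <= tau ^+ 2 * dual_sum phi lam l N.
Proof.
rewrite /dual_sum mulr_sumr; apply: ler_sum => k _.
rewrite noise_coef_sqr ler_wpM2l ?sqr_ge0// ler_wpM2l ?sqr_ge0//.
by rewrite lef_pV2 ?posrE ?addr_gt0// lerDr.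
Qed.

(** Here 1 / lam k <= (1 + 1 / m) / (1 + lam k), as m <= lam k.  The bound m
is kept apart from lam 0, so that one m can serve all eigenbases. *)
Lemma dual_sum_le_noise_sum (m : R) N : 0 < m -> m <= lam 0 ->
  dual_sum phi lam l N <= (1 + m^-1) / tau ^+ 2 * noise_sum N.
Proof.
move=> m0 mlam; rewrite /noise_sum mulr_sumr; apply: ler_sum => k _.
have lk := lam_gt0 k; have mk := le_trans mlam (eigenvalue_ge basis k).
have tau_neq0 : tau != 0 by rewrite gt_eqF.
rewrite noise_coef_sqr.
have -> : (1 + m^-1) / tau ^+ 2 * (tau ^+ 2 * (l (phi k) ^+ 2 / (1 + lam k))) =
    l (phi k) ^+ 2 * ((1 + m^-1) / (1 + lam k)).
  by field; rewrite tau_neq0 !gt_eqF ?addr_gt0.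
rewrite ler_wpM2l ?sqr_ge0// ler_pdivlMr ?addr_gt0// mulrDr mulr1.
rewrite mulVf ?gt_eqF//.
by rewrite addrC lerD2l lef_pV2 ?posrE.
Qed.

Lemma is_cvg_noise_sum : cvgn noise_sum.
Proof.
apply: nondecreasing_is_cvgn.
  apply/nondecreasing_seqP => N; rewrite /noise_sum big_ord_recr/= lerDl.
  exact: sqr_ge0.
exists (tau ^+ 2 * limn (dual_sum phi lam l)) => _ [N _ <-].
rewrite (le_trans (noise_sum_le N))// ler_wpM2l ?sqr_ge0//.
exact: (dual_sum_le_lim oO basis Hl).
Qed.

Lemma ae_cvg_residual :
  {ae mu, forall xi, cvgn (fun N => l (Phi phi lam tau w N xi))}.
Proof.
apply: filterS (random_series_cvg wn is_cvg_noise_sum) => xi.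
by under [X in _ -> cvgn X]eq_fun do rewrite Hm1_Phi.
Qed.

Lemma cvg_mean_sq :
  mean_sq phi lam tau w l @ \oo --> (limn noise_sum)%:E.
Proof.
rewrite (_ : mean_sq _ _ _ _ _ = EFin \o noise_sum); last first.
  by apply/funext => N; exact: mean_sq_noise_sum.
by apply: cvg_EFin; [exact: nearW|exact: is_cvg_noise_sum].
Qed.

Lemma Hm1_norm_sqrE :
  (Hm1_norm Omega phi lam l ^+ 2 = (limn (dual_sum phi lam l))%:E)%E.
Proof.
rewrite (Hm1_normE oO basis Hl) -EFin_expe sqr_sqrtr//.
exact: le_trans (dual_sum_ge0 basis l 0) (dual_sum_le_lim oO basis Hl 0).
Qed.

Lemma Phi_sqnorm_equiv (m : R) : 0 < m -> m <= lam 0 ->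
  [/\ cvgn (mean_sq phi lam tau w l),
      ((tau ^- 2)%:E * Phi_sqnorm phi lam tau w l
        <= Hm1_norm Omega phi lam l ^+ 2)%E &
      (Hm1_norm Omega phi lam l ^+ 2
        <= ((1 + m^-1) / tau ^+ 2)%:E * Phi_sqnorm phi lam tau w l)%E].
Proof.
move=> m0 mlam; have c := cvg_mean_sq.
have cq := is_cvg_dual_sum oO basis Hl; have cp := is_cvg_noise_sum.
split; first by apply/cvg_ex; eexists; exact: c.
- rewrite /Phi_sqnorm (cvg_lim _ c)// Hm1_norm_sqrE -EFinM lee_fin.
  rewrite ler_pdivrMl ?exprn_gt0// limn_le_scaled// => N.
  exact: noise_sum_le.
- rewrite /Phi_sqnorm (cvg_lim _ c)// Hm1_norm_sqrE -EFinM lee_fin.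
  by rewrite limn_le_scaled// => N; exact: dual_sum_le_noise_sum.
Qed.

End residual_under_noise.

Lemma Hm1_residual (R : realType) (n : nat) (Omega : set 'rV[R]_n)
    (phi : nat -> 'rV[R]_n -> R) (lam : nat -> R) L f u :
  elliptic_problem Omega phi lam L f -> H01 Omega phi lam u ->
  Hm1 Omega phi lam (residual L f u).
Proof.
move=> [_ HL [linf [Mf boundf]] _] Hu; have [linL [ML boundL]] := HL u Hu.
split; first by move=> a v z Hv Hz; rewrite /residual linL// linf//; ring.
exists (ML + Mf) => v Hv; rewrite (le_trans (ler_normB _ _))// mulrDl lerD//.
  exact: boundL.
exact: boundf.
Qed.

Theorem proposition3p3 (R : realType) (n : nat) (Omega : set 'rV[R]_n.+1)
    (Omega_open : open Omega) (Omega_bounded : bounded_set Omega)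
    (Omega_connected : connected Omega)
    (Omega_lipschitz : lipschitz_boundary Omega)
    (tau : R) (tau_gt0 : 0 < tau) :
  (forall (phi : nat -> 'rV[R]_n.+1 -> R) (lam : nat -> R)
      (L : ('rV[R]_n.+1 -> R) -> ('rV[R]_n.+1 -> R) -> R)
      (f : ('rV[R]_n.+1 -> R) -> R)
      (d : measure_display) (Xi : measurableType d) (mu : probability Xi R)
      (w : nat -> {RV mu >-> R}),
    dirichlet_eigenbasis Omega phi lam ->
    elliptic_problem Omega phi lam L f ->
    white_noise w ->
    forall u, H01 Omega phi lam u ->
      {ae mu, forall xi : Xi,
        cvgn (fun N => residual L f u (Phi phi lam tau w N xi))}) /\
  (exists c C : R, [/\ 0 < c, 0 < C &
    forall (phi : nat -> 'rV[R]_n.+1 -> R) (lam : nat -> R)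
      (L : ('rV[R]_n.+1 -> R) -> ('rV[R]_n.+1 -> R) -> R)
      (f : ('rV[R]_n.+1 -> R) -> R)
      (d : measure_display) (Xi : measurableType d) (mu : probability Xi R)
      (w : nat -> {RV mu >-> R}),
    dirichlet_eigenbasis Omega phi lam ->
    elliptic_problem Omega phi lam L f ->
    white_noise w ->
    forall u, H01 Omega phi lam u ->
      [/\ cvgn (mean_sq phi lam tau w (residual L f u)),
          (c%:E * Phi_sqnorm phi lam tau w (residual L f u)
            <= Hm1_norm Omega phi lam (residual L f u) ^+ 2)%E &
          (Hm1_norm Omega phi lam (residual L f u) ^+ 2
            <= C%:E * Phi_sqnorm phi lam tau w (residual L f u))%E]]).
Proof.
split=> [phi lam L f d Xi mu w basis ell wn u Hu|].
  exact: (ae_cvg_residual Omega_open basis (Hm1_residual ell Hu) wn).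
(* A lower bound for the first eigenvalue of every eigenbasis: that of any
   fixed one, or an arbitrary number if there are none. *)
have [m m0 mlam] : exists2 m : R, 0 < m &
    forall phi lam, dirichlet_eigenbasis Omega phi lam -> m <= lam 0.
  have [[phi0 [lam0 basis0]]|none] := pselect (exists phi lam,
      dirichlet_eigenbasis Omega phi lam).
    exists (lam0 0); first exact: (eigenvalue_gt0 basis0).
    by move=> phi lam; exact: first_eigenvalue_le basis0.
  by exists 1 => // phi lam basis; case: none; exists phi, lam.
exists (tau ^- 2), ((1 + m^-1) / tau ^+ 2); split.
- by rewrite invr_gt0 exprn_gt0.
- by rewrite divr_gt0 ?exprn_gt0// addr_gt0 ?invr_gt0.
- move=> phi lam L f d Xi mu w basis ell wn u Hu.
  exact: (Phi_sqnorm_equiv Omega_open basis (Hm1_residual ell Hu) wn tau_gt0 m0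
    (mlam _ _ basis)).
Qed.
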